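(* For positive integers $a,b$ let $(f_{a,b}[n])_{n\ge 1}$ be defined by $f_{a,b}[1]=f_{a,b}[2]=1$ and $f_{a,b}[n]=a f_{a,b}[n-1]+b f_{a,b}[n-2]$ for $n\ge 3$. For each positive integer $N$ let $\bar{X}_{a,b,N}$ and $\underline{X}_{a,b,N}$ be random variables with values in $\{1,\dots,N\}$ and $$P(\bar{X}_{a,b,N}=n)=\frac{f_{a,b}[n]}{\sum_{k=1}^{N}f_{a,b}[k]},\qquad P(\underline{X}_{a,b,N}=n)=\frac{f_{a,b}[N+1-n]}{\sum_{k=1}^{N}f_{a,b}[k]}\qquad(1\le n\le N).$$ Then $$\max_{a,b\in\mathbb{N}}\ \lim_{N\to\infty}\mathrm{Var}(\bar{X}_{a,b,N})=\max_{a,b\in\mathbb{N}}\ \lim_{N\to\infty}\mathrm{Var}(\underline{X}_{a,b,N})=\lim_{N\to\infty}\mathrm{Var}(\underline{X}_{1,1,N})=2\varphi+1,$$ where $\varphi=\frac{1+\sqrt5}{2}$.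
   Context: $\mathbb{N}$ is the set of positive integers and $\mathrm{Var}$ denotes variance. The case $a=b=1$ is the classical Fibonacci sequence. *)

(* Defs.v *)
From mathcomp Require Import all_boot all_order all_algebra.
From mathcomp Require Import all_classical all_reals all_analysis.

Set Implicit Arguments.
Unset Strict Implicit.
Unset Printing Implicit Defensive.

Import Order.TTheory GRing.Theory Num.Theory.
Import numFieldNormedType.Exports.

Local Open Scope classical_set_scope.
Local Open Scope ring_scope.

(* The recurrence starts at index 3; the value at index 0 is a placeholder,
   read neither by the recurrence nor by the distributions below. *)
Fixpoint gfib (a b n : nat) : nat :=
  match n with
  | 0 => 0
  | 1 => 1
  | (n1.+1 as n2).+1 =>
      if n1 is 0 then 1 else (a * gfib a b n2 + b * gfib a b n1)%N
  end.

Definition gfib_sum (a b N : nat) : nat := (\sum_(1 <= k < N.+1) gfib a b k)%N.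

Definition prob_up (R : realType) (a b N n : nat) : R :=
  (gfib a b n)%:R / (gfib_sum a b N)%:R.

Definition prob_down (R : realType) (a b N n : nat) : R :=
  (gfib a b (N.+1 - n))%:R / (gfib_sum a b N)%:R.

Definition distributed_on (d : measure_display) (T : measurableType d)
    (R : realType) (P : probability T R) (X : {RV P >-> R})
    (N : nat) (p : nat -> R) : Prop :=
  (forall t : T, exists2 n : nat, (1 <= n <= N)%N & X t = n%:R) /\
  (forall n : nat, (1 <= n <= N)%N -> pmf X n%:R = p n).

Definition is_max (R : realType) (A : set (\bar R)) (m : \bar R) : Prop :=
  A m /\ ubound A m.

Definition posn : set nat := [set n | (0 < n)%N].

Definition golden_ratio (R : realType) : R := (1 + Num.sqrt 5) / 2.

(* Main.v *)
(* Let lam > 0 be the dominant root of X^2 - a X - b.  Both random variables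
   are, up to sign and translation, the gap N - n for n drawn with weight
   f[n], so they have the same variance.  Divided by lam^N, the k-th gap moment
   sum_(n <= N) (N - n)^k f[n] (k = 0, 1, 2) satisfies
   x_(N+1) = x_N / lam + y_N, where y_N is a combination of the lower moments
   (for k = 0, y_N = f[N+1] / lam^(N+1)), so it converges as soon as
   y_N does.  The limit of the variance is that of a geometric law of ratio
   1 / lam, namely lam / (lam - 1)^2.  It decreases in lam > 1, and lam is
   smallest for a = b = 1, where lam is the golden ratio. *)

Require Import Defs.
From mathcomp Require Import all_boot all_order all_algebra.
From mathcomp Require Import all_classical all_reals all_analysis.
From mathcomp Require Import ring lra.

Set Implicit Arguments.
Unset Strict Implicit.
Unset Printing Implicit Defensive.

Import Order.TTheory GRing.Theory Num.Theory.
Import numFieldNormedType.Exports.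

Local Open Scope classical_set_scope.
Local Open Scope ring_scope.

(** * Limits of affine recurrences *)

(** The error to the fixed point [l / (1 - q)] is multiplied by [q] at each step and perturbed by
    [l - y n]. Once the perturbation is at most [e / 2 * (1 - |q|)], its accumulated effect stays
    below [e / 2], and the initial error decays geometrically. *)
Lemma cvg_affine_rec (R : realType) (q l : R) (x y : R^nat) :
  `|q| < 1 -> (forall n, x n.+1 = q * x n + y n) ->
  y n @[n --> \oo] --> l -> x n @[n --> \oo] --> l / (1 - q).
Proof.
move=> q1 xS yl; have q_lt1 : q < 1 by exact: ltr_normlW.
have nq0 : 0 < 1 - `|q| by rewrite subr_gt0.
have q0 : 1 - q != 0 by rewrite subr_eq0 gt_eqF.
apply/cvgrPdist_le => e e0.
have [M _ yM] : \forall n \near \oo, `|l - y n| <= e / 2 * (1 - `|q|).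
  by move/cvgrPdist_le : yl; apply; rewrite mulr_gt0// divr_gt0.
pose d := `|l / (1 - q) - x M|.
have dist k : `|l / (1 - q) - x (k + M)%N| <= d * `|q| ^+ k + e / 2.
  elim: k => [|k IH]; first by rewrite expr0 mulr1 lerDl divr_ge0// ltW.
  rewrite addSn xS.
  have -> : l / (1 - q) - (q * x (k + M)%N + y (k + M)%N) =
      q * (l / (1 - q) - x (k + M)%N) + (l - y (k + M)%N) by field.
  apply: le_trans (ler_normD _ _) _; rewrite normrM.
  have := ler_wpM2l (normr_ge0 q) IH.
  by have := yM (k + M)%N (leq_addl _ _); rewrite /= exprS; lra.
have [K _ qK] : \forall k \near \oo, `|0 - geometric d `|q| k| <= e / 2.
  have /cvgrPdist_le := cvg_geometric d (etrans (congr1 (<%R^~ 1) (normr_id q)) q1).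
  by apply; rewrite divr_gt0.
exists (K + M)%N => // n /= KMn.
have Mn : (M <= n)%N by rewrite (leq_trans _ KMn)// leq_addl.
rewrite -(subnK Mn); apply: le_trans (dist _) _.
have : (K <= n - M)%N by rewrite leq_subRL// addnC.
move/(qK _); rewrite sub0r normrN => /(le_trans (ler_norm _)) /=.
by lra.
Qed.

(** * Exponential growth of the sequence *)

Lemma gfibSSS a b n :
  gfib a b n.+3 = (a * gfib a b n.+2 + b * gfib a b n.+1)%N.
Proof. by []. Qed.

(* [a - lam] is the other root of [X^2 - a X - b], so [lam] factors out of the recurrence. *)
Lemma gfib_first_order (R : realType) (a b : nat) (lam : R) n :
  lam ^+ 2 = a%:R * lam + b%:R ->
  (gfib a b n.+2)%:R = (a%:R - lam) * (gfib a b n.+1)%:R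
                       + (1 + lam - a%:R) * lam ^+ n.
Proof.
move=> lamE; elim: n => [|n IH]; first by rewrite /= expr0; ring.
rewrite gfibSSS natrD !natrM.
have -> : b%:R = lam ^+ 2 - a%:R * lam :> R by rewrite lamE; ring.
rewrite (exprS lam n).
have -> : (1 + lam - a%:R) * (lam * lam ^+ n) =
  lam * ((gfib a b n.+2)%:R - (a%:R - lam) * (gfib a b n.+1)%:R).
  by rewrite IH; ring.
by ring.
Qed.

(** This yields [1 < lam] when [a] is positive, and places the other root [a - lam] strictly between
    [- lam] and 0. *)
Lemma char_root_gt (R : realType) (a b : nat) (lam : R) : (0 < b)%N ->
  0 < lam -> lam ^+ 2 = a%:R * lam + b%:R -> a%:R < lam.
Proof.
move=> b0 lam0 lamE; rewrite -subr_gt0 -(pmulr_rgt0 _ lam0).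
have -> : lam * (lam - a%:R) = b%:R.
  by rewrite mulrBr -expr2 lamE; ring.
by rewrite ltr0n.
Qed.

(** Dividing the first-order relation by [lam ^+ n.+2] gives an affine recurrence with ratio
    [q = (a - lam) / lam] and constant term [h]. The limit must be nonzero because it later appears
    in a denominator. *)
Lemma gfib_growth (R : realType) (a b : nat) (lam : R) :
  (0 < a)%N -> (0 < b)%N -> 0 < lam -> lam ^+ 2 = a%:R * lam + b%:R ->
  exists2 c : R, 0 < c & (gfib a b n)%:R / lam ^+ n @[n --> \oo] --> c.
Proof.
move=> a0 b0 lam0 lamE; have alam := char_root_gt b0 lam0 lamE.
have lamN0 : lam != 0 by rewrite gt_eqF.
pose q := (a%:R - lam) / lam; pose h := (1 + lam - a%:R) / lam ^+ 2.
have aR0 : 0 < a%:R :> R by rewrite ltr0n.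
have q1 : `|q| < 1.
  by rewrite /q normrM normfV (gtr0_norm lam0) ltr_pdivrMr// mul1r ltr0_norm; lra.
have q_lt1 := ltr_normlW q1.
exists (h / (1 - q)).
  by rewrite divr_gt0 ?subr_gt0// /h divr_gt0 ?exprn_gt0//; lra.
rewrite -(cvg_shiftS (fun n => (gfib a b n)%:R / lam ^+ n)).
apply: (@cvg_affine_rec _ q h _ (fun=> h)) => //; last exact: cvg_cst.
move=> n /=; rewrite (gfib_first_order n lamE) /q /h !exprS.
by field; rewrite lamN0 expf_neq0.
Qed.

(** * Gap moments and the limit of their variance *)

(** The moments are left unnormalized so that passing from [N] to [N.+1] is linear. *)
Definition gap_moment (R : realType) (a b k N : nat) : R :=
  \sum_(1 <= n < N.+1) (N%:R - n%:R) ^+ k * (gfib a b n)%:R.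

Lemma gap_moment0 (R : realType) (a b N : nat) :
  gap_moment R a b 0 N = (gfib_sum a b N)%:R.
Proof.
rewrite /gap_moment /gfib_sum natr_sum.
by apply: eq_bigr => n _; rewrite expr0 mul1r.
Qed.

Lemma gap_moment0S (R : realType) (a b N : nat) :
  gap_moment R a b 0 N.+1 = gap_moment R a b 0 N + (gfib a b N.+1)%:R.
Proof.
by rewrite /gap_moment big_nat_recr//= expr0 mul1r.
Qed.

(** The new index has gap 0 and contributes nothing, while every earlier gap grows by one; expanding
    the power brings in the lower moments. *)
Lemma gap_moment1S (R : realType) (a b N : nat) :
  gap_moment R a b 1 N.+1 = gap_moment R a b 1 N + gap_moment R a b 0 N.
Proof.
rewrite /gap_moment big_nat_recr//= subrr expr1 mul0r addr0 -big_split /=.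
by apply: eq_bigr => n _; rewrite -natr1; ring.
Qed.

Lemma gap_moment2S (R : realType) (a b N : nat) :
  gap_moment R a b 2 N.+1 =
    gap_moment R a b 2 N + (2 * gap_moment R a b 1 N + gap_moment R a b 0 N).
Proof.
rewrite /gap_moment big_nat_recr//= subrr expr0n mul0r addr0.
rewrite mulr_sumr -!big_split /=.
by apply: eq_bigr => n _; rewrite -natr1; ring.
Qed.

Lemma cvg_gap_variance (R : realType) (a b : nat) (lam : R) :
  (0 < a)%N -> (0 < b)%N -> 0 < lam -> lam ^+ 2 = a%:R * lam + b%:R ->
  (gap_moment R a b 2 N / gap_moment R a b 0 N
    - (gap_moment R a b 1 N / gap_moment R a b 0 N) ^+ 2) @[N --> \oo]
  --> lam / (lam - 1) ^+ 2.
Proof.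
move=> a0 b0 lam0 lamE; have alam := char_root_gt b0 lam0 lamE.
have lam1 : 1 < lam by apply: le_lt_trans alam; rewrite ler1n.
have lamN0 : lam != 0 by rewrite gt_eqF.
have lamN1 : lam - 1 != 0 by rewrite subr_eq0 gt_eqF.
have [c c0 fc] := gfib_growth a0 b0 lam0 lamE.
pose q := lam^-1; pose D k N := gap_moment R a b k N / lam ^+ N.
have q1 : `|q| < 1 by rewrite /q ger0_norm ?invr_ge0 ?ltW// invf_lt1.
have cD0 : D 0 N @[N --> \oo] --> c / (1 - q).
  apply: (@cvg_affine_rec _ q c _
    (fun N => (gfib a b N.+1)%:R / lam ^+ N.+1)) => // [N|].
    by rewrite /D gap_moment0S /q exprS; field; rewrite lamN0 expf_neq0.
  by rewrite (cvg_shiftS (fun n => (gfib a b n)%:R / lam ^+ n)).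
have cD1 : D 1 N @[N --> \oo] --> q * (c / (1 - q)) / (1 - q).
  apply: (@cvg_affine_rec _ q _ _ (fun N => q * D 0 N)) => // [N|].
    by rewrite /D gap_moment1S /q exprS; field; rewrite lamN0 expf_neq0.
  by apply: cvgM => //; exact: cvg_cst.
have cD2 : D 2 N @[N --> \oo] -->
    q * (2 * (q * (c / (1 - q)) / (1 - q)) + c / (1 - q)) / (1 - q).
  apply: (@cvg_affine_rec _ q _ _ (fun N => q * (2 * D 1 N + D 0 N))) => // [N|].
    by rewrite /D gap_moment2S /q exprS; field; rewrite lamN0 expf_neq0.
  apply: cvgM; first exact: cvg_cst.
  by apply: cvgD => //; apply: cvgM => //; exact: cvg_cst.
have qN1 : 1 - q != 0 by rewrite subr_eq0 gt_eqF// ltr_normlW.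
have cN0 : c != 0 by rewrite gt_eqF.
have D0N0 : c / (1 - q) != 0 by rewrite mulf_neq0// invr_neq0.
(* The scaling by [lam ^+ N] is common to numerator and denominator. *)
have normalize k N : gap_moment R a b k N / gap_moment R a b 0 N = D k N / D 0 N.
  by rewrite /D invfM invrK mulrACA (mulrC (lam ^+ N)^-1) mulfV ?expf_neq0// mulr1.
have ratio k (l : R) : D k N @[N --> \oo] --> l ->
    D k N / D 0 N @[N --> \oo] --> l / (c / (1 - q)).
  by move=> Dl; apply: cvgM => //; exact: cvgV.
(* The constant [c] cancels: the normalized limits are the moments [q (1 + q) / (1 - q)^2] and
   [q / (1 - q)] of the geometric law. *)
have -> : lam / (lam - 1) ^+ 2 =
    q * (2 * (q * (c / (1 - q)) / (1 - q)) + c / (1 - q)) / (1 - q) / (c / (1 - q))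
    - (q * (c / (1 - q)) / (1 - q) / (c / (1 - q))) ^+ 2.
  by rewrite /q; field; rewrite lamN0 lamN1 cN0.
under eq_cvg do rewrite !normalize expr2.
rewrite expr2; apply: cvgB; first exact: ratio.
by apply: cvgM; exact: ratio.
Qed.

(** * Variance of a finitely supported law *)

(** Since [X] takes finitely many values, [g \o X] is a finite combination of indicators of its
    fibers, integrated term by term. *)
Lemma expectation_distributed (d : measure_display) (T : measurableType d)
    (R : realType) (P : probability T R) (X : {RV P >-> R})
    (N : nat) (p : nat -> R) (g : R -> R) :
  distributed_on X N p ->
  'E_P[g \o X]%E = (\sum_(1 <= n < N.+1) g n%:R * p n)%:E.
Proof.
move=> [XN Xp]; rewrite unlock.
have mX n : measurable (X @^-1` [set n%:R : R]).
  by rewrite -[_ @^-1` _]setTI; exact: (measurable_funP X).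
have gX t : (g (X t))%:E =
    (\sum_(1 <= n < N.+1) ((g n%:R)%:E * (\1_(X @^-1` [set n%:R : R]) t)%:E))%E.
  have [m mN Xm] := XN t.
  rewrite (bigD1_seq m) ?mem_index_iota ?iota_uniq//=.
  rewrite indicE mem_set// mule1 big1 ?adde0 ?Xm// => n nm.
  rewrite indicE memNset ?mule0//= Xm => /eqP.
  by rewrite eqr_nat eq_sym (negbTE nm).
under eq_integral do rewrite /= gX.
rewrite integral_sum// => [|n]; last exact/integrableZl/integrable_indic.
rewrite -sumEFin; apply: eq_big_nat => n nN.
rewrite integralZl//; last exact: integrable_indic.
by rewrite integral_indic// setIT EFinM -Xp// /pmf fineK// fin_num_measure.
Qed.

(** Variance ignores the translation [c] and the sign [e]; allowing both signs covers the reflected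
    gap [N - n] as well as the shifted index [n - 1]. *)
Lemma sum_variance_affine (R : realType) (s : seq nat) (x y p : nat -> R) (c e : R) :
  e ^+ 2 = 1 -> (forall n, x n = c + e * y n) -> \sum_(n <- s) p n = 1 ->
  \sum_(n <- s) (x n - \sum_(n <- s) x n * p n) ^+ 2 * p n =
  \sum_(n <- s) y n ^+ 2 * p n - (\sum_(n <- s) y n * p n) ^+ 2.
Proof.
move=> e1 xE p1; move ME : (\sum_(n <- s) y n * p n) => M.
have -> : \sum_(n <- s) x n * p n = c + e * M.
  rewrite -ME -[c in RHS]mulr1 -p1 !mulr_sumr -big_split /=.
  by apply: eq_bigr => n _; rewrite xE; ring.
transitivity (\sum_(n <- s) y n ^+ 2 * p n
    - 2 * M * (\sum_(n <- s) y n * p n) + M ^+ 2 * \sum_(n <- s) p n).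
  rewrite !mulr_sumr -sumrB -big_split /=; apply: eq_bigr => n _; rewrite xE.
  have -> : (c + e * y n - (c + e * M)) ^+ 2 = e ^+ 2 * (y n - M) ^+ 2 by ring.
  by rewrite e1; ring.
by rewrite p1 ME; ring.
Qed.

Lemma variance_distributed (d : measure_display) (T : measurableType d)
    (R : realType) (P : probability T R) (X : {RV P >-> R})
    (N : nat) (p y : nat -> R) (c e : R) :
  distributed_on X N p -> \sum_(1 <= n < N.+1) p n = 1 ->
  e ^+ 2 = 1 -> (forall n, n%:R = c + e * y n) ->
  'V_P[X]%E = (\sum_(1 <= n < N.+1) y n ^+ 2 * p n
               - (\sum_(1 <= n < N.+1) y n * p n) ^+ 2)%:E.
Proof.
move=> Xp p1 e1 yE; rewrite -(sum_variance_affine e1 yE p1).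
have EX : 'E_P[X]%E = (\sum_(1 <= n < N.+1) n%:R * p n)%:E.
  exact: (expectation_distributed id Xp).
rewrite /variance covariance.unlock EX /=.
set m := \sum_(1 <= n < N.+1) n%:R * p n.
by rewrite -(expectation_distributed (fun r => (r - m) ^+ 2) Xp).
Qed.

(** * Both variances in terms of gap moments *)

Lemma gfib_sum_gt0 (a b N : nat) : (0 < N)%N -> (0 < gfib_sum a b N)%N.
Proof. by case: N => // N _; rewrite /gfib_sum big_ltn. Qed.

Lemma prob_up_sum (R : realType) (a b N : nat) : (0 < N)%N ->
  \sum_(1 <= n < N.+1) prob_up R a b N n = 1.
Proof.
move=> N0; rewrite -mulr_suml -natr_sum divff// pnatr_eq0 -lt0n.
exact: gfib_sum_gt0.
Qed.

(** The reflection of the index [n] to [N + 1 - n] exchanges the two laws. *)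
Lemma prob_down_rev (R : realType) (a b N : nat) (g : R -> R) :
  \sum_(1 <= n < N.+1) g n%:R * prob_down R a b N n =
  \sum_(1 <= n < N.+1) g (N.+1%:R - n%:R) * prob_up R a b N n.
Proof.
rewrite big_nat_rev; apply: eq_big_nat => n /andP[n1 nN].
rewrite add1n subSS /prob_down /prob_up subKn; last exact: leqW.
by rewrite natrB// leqW.
Qed.

Lemma sum_gap_prob_up (R : realType) (a b N k : nat) :
  \sum_(1 <= n < N.+1) (N%:R - n%:R) ^+ k * prob_up R a b N n =
  gap_moment R a b k N / gap_moment R a b 0 N.
Proof.
by rewrite gap_moment0 mulr_suml; apply: eq_bigr => n _; rewrite mulrA.
Qed.

Lemma variance_up (d : measure_display) (T : measurableType d)
    (R : realType) (P : probability T R) (X : {RV P >-> R}) (a b N : nat) :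
  (0 < N)%N -> distributed_on X N (prob_up R a b N) ->
  'V_P[X]%E = (gap_moment R a b 2 N / gap_moment R a b 0 N
               - (gap_moment R a b 1 N / gap_moment R a b 0 N) ^+ 2)%:E.
Proof.
move=> N0 Xp.
rewrite (@variance_distributed _ _ _ _ _ N _ (fun n => N%:R - n%:R) N%:R (-1) Xp)//.
- by rewrite -!sum_gap_prob_up.
- exact: prob_up_sum.
- by rewrite sqrrN expr1n.
- by move=> n; ring.
Qed.

Lemma variance_down (d : measure_display) (T : measurableType d)
    (R : realType) (P : probability T R) (X : {RV P >-> R}) (a b N : nat) :
  (0 < N)%N -> distributed_on X N (prob_down R a b N) ->
  'V_P[X]%E = (gap_moment R a b 2 N / gap_moment R a b 0 N
               - (gap_moment R a b 1 N / gap_moment R a b 0 N) ^+ 2)%:E.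
Proof.
move=> N0 Xp.
(* The translate [n - 1] is chosen because reflection turns it into the gap [N - n]. *)
rewrite (@variance_distributed _ _ _ _ _ N _ (fun n => n%:R - 1) 1 1 Xp).
- rewrite -!sum_gap_prob_up (prob_down_rev _ _ _ (fun r => (r - 1) ^+ 2)).
  rewrite (prob_down_rev _ _ _ (fun r => r - 1)).
  congr (_ - _ ^+ 2)%:E; apply: eq_bigr => n _; rewrite -natr1; congr (_ * _); ring.
- under eq_bigr do rewrite -[prob_down _ _ _ _ _]mul1r.
  rewrite (prob_down_rev _ _ _ (fun=> 1)).
  by under eq_bigr do rewrite mul1r; exact: prob_up_sum.
- by rewrite expr1n.
- by move=> n; ring.
Qed.

(** * The dominant root and the maximal limit variance *)

Definition char_root (R : realType) (a b : nat) : R :=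
  (a%:R + Num.sqrt (a%:R ^+ 2 + 4 * b%:R)) / 2.

Lemma char_rootE (R : realType) (a b : nat) :
  char_root R a b ^+ 2 = a%:R * char_root R a b + b%:R.
Proof.
rewrite /char_root; set s := Num.sqrt _.
have s2 : s ^+ 2 = a%:R ^+ 2 + 4 * b%:R.
  by rewrite sqr_sqrtr// addr_ge0 ?sqr_ge0// mulr_ge0.
have -> : b%:R = (s ^+ 2 - a%:R ^+ 2) / 4 :> R by rewrite s2; field.
by field.
Qed.

Lemma char_root_gt0 (R : realType) (a b : nat) : (0 < a)%N -> 0 < char_root R a b.
Proof. by move=> a0; rewrite divr_gt0// ltr_pwDl ?ltr0n// sqrtr_ge0. Qed.

Lemma golden_ratio_le_char_root (R : realType) (a b : nat) :
  (0 < a)%N -> (0 < b)%N -> golden_ratio R <= char_root R a b.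
Proof.
move=> a0 b0; rewrite ler_pM2r ?invr_gt0// lerD ?ler1n// ler_wsqrtr//.
have a1 : 1 <= a%:R :> R by rewrite ler1n.
have b1 : 1 <= b%:R :> R by rewrite ler1n.
by rewrite expr2; nra.
Qed.

Lemma char_root11 (R : realType) : char_root R 1 1 = golden_ratio R.
Proof. by rewrite /char_root /golden_ratio expr1n; congr ((_ + Num.sqrt _) / _); ring. Qed.

Lemma golden_ratio_gt1 (R : realType) : 1 < golden_ratio R.
Proof.
rewrite -char_root11; apply: (@char_root_gt _ 1 1) => //; last exact: char_rootE.
exact: char_root_gt0.
Qed.

Lemma golden_ratio_geometric_variance (R : realType) :
  golden_ratio R / (golden_ratio R - 1) ^+ 2 = 2 * golden_ratio R + 1.
Proof.
have phi1 := golden_ratio_gt1 R.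
have := char_rootE R 1 1; rewrite char_root11 mul1r.
move: (golden_ratio R) phi1 => x x1 x2.
have xN1 : (x - 1) ^+ 2 != 0 by rewrite expf_neq0// subr_eq0 gt_eqF.
apply/eqP; rewrite eq_sym -(can2_eq (mulfK xN1) (mulfVK xN1)); apply/eqP.
(* With denominators cleared, repeated reduction by [x ^+ 2 = x + 1] brings this cubic down to
   [x]. *)
have -> : (2 * x + 1) * (x - 1) ^+ 2 =
  (2 * x - 3) * (x ^+ 2) + 1 by ring.
have -> : (2 * x - 3) * (x ^+ 2) + 1 = 2 * x ^+ 2 - x - 2 by rewrite x2; lra.
by rewrite x2; ring.
Qed.

(** Clearing denominators leaves the difference [(y - x) (x y - 1)], whose factors are
    nonnegative. *)
Lemma geometric_variance_le (R : realType) (x y : R) :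
  1 < x -> x <= y -> y / (y - 1) ^+ 2 <= x / (x - 1) ^+ 2.
Proof.
move=> x1 xy; have x0 : 0 < x - 1 by lra.
have y0 : 0 < y - 1 by lra.
rewrite ler_pdivrMr ?exprn_gt0// mulrAC ler_pdivlMr ?exprn_gt0//.
rewrite -subr_ge0.
have -> : x * (y - 1) ^+ 2 - y * (x - 1) ^+ 2 = (y - x) * (x * y - 1) by ring.
by rewrite mulr_ge0//; nra.
Qed.

(** Convergence is asserted separately because [limn] is a total operator, whose value is the limit
    only for convergent sequences. *)
Theorem theorem4p6 (R : realType)
  (d1 d2 : nat -> nat -> nat -> measure_display)
  (T1 : forall a b N : nat, measurableType (d1 a b N))
  (T2 : forall a b N : nat, measurableType (d2 a b N))
  (P1 : forall a b N : nat, probability (T1 a b N) R)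
  (P2 : forall a b N : nat, probability (T2 a b N) R)
  (Xup : forall a b N : nat, {RV (P1 a b N) >-> R})
  (Xdown : forall a b N : nat, {RV (P2 a b N) >-> R})
  (hup : forall a b N : nat, (0 < a)%N -> (0 < b)%N -> (0 < N)%N ->
    distributed_on (Xup a b N) N (prob_up R a b N))
  (hdown : forall a b N : nat, (0 < a)%N -> (0 < b)%N -> (0 < N)%N ->
    distributed_on (Xdown a b N) N (prob_down R a b N)) :
  let Vup (a b N : nat) : \bar R := 'V_(P1 a b N)[Xup a b N]%E in
  let Vdown (a b N : nat) : \bar R := 'V_(P2 a b N)[Xdown a b N]%E in
  let m : \bar R := (2 * golden_ratio R + 1)%:E in
  [/\ forall a b : nat, (0 < a)%N -> (0 < b)%N ->
        cvgn (Vup a b) /\ cvgn (Vdown a b),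
      is_max [set limn (Vup a b) | a in posn & b in posn] m,
      is_max [set limn (Vdown a b) | a in posn & b in posn] m &
      limn (Vdown 1%N 1%N) = m].
Proof.
move=> Vup Vdown m.
have conv (V : nat -> \bar R) a b : (0 < a)%N -> (0 < b)%N ->
    (forall N, (0 < N)%N -> V N = (gap_moment R a b 2 N / gap_moment R a b 0 N
      - (gap_moment R a b 1 N / gap_moment R a b 0 N) ^+ 2)%:E) ->
    V N @[N --> \oo] --> (char_root R a b / (char_root R a b - 1) ^+ 2)%:E.
  (* The variance formula holds only for positive [N], hence the shift by one. *)
  move=> a0 b0 VE; rewrite -(cvg_shiftS V).
  under eq_cvg do rewrite /= VE//.
  apply: cvg_EFin; first exact: nearW.
  have := cvg_gap_variance a0 b0 (char_root_gt0 R b a0) (char_rootE R a b).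
  by rewrite -cvg_shiftS.
have cup a b (a0 : (0 < a)%N) (b0 : (0 < b)%N) :=
  conv (Vup a b) a b a0 b0 (fun N N0 => variance_up N0 (hup a b N a0 b0 N0)).
have cdown a b (a0 : (0 < a)%N) (b0 : (0 < b)%N) :=
  conv (Vdown a b) a b a0 b0 (fun N N0 => variance_down N0 (hdown a b N a0 b0 N0)).
have mE : m = (char_root R 1 1 / (char_root R 1 1 - 1) ^+ 2)%:E.
  by rewrite char_root11 golden_ratio_geometric_variance.
(* Only the limits matter here, so one argument serves both families; the maximum is attained at
   [a = b = 1]. *)
have maxV (V : nat -> nat -> nat -> \bar R) :
    (forall a b, (0 < a)%N -> (0 < b)%N ->
      V a b N @[N --> \oo] --> (char_root R a b / (char_root R a b - 1) ^+ 2)%:E) ->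
    is_max [set limn (V a b) | a in posn & b in posn] m.
  move=> cV; split.
    by exists 1%N => //; exists 1%N => //; rewrite mE; apply/cvg_lim => //; exact: cV.
  move=> _ [a a0 [b b0 <-]]; rewrite (cvg_lim _ (cV a b a0 b0))// mE lee_fin.
  rewrite char_root11; apply: geometric_variance_le; first exact: golden_ratio_gt1.
  exact: golden_ratio_le_char_root.
split.
- by move=> a b a0 b0; split; apply/cvg_ex; eexists; [exact: cup|exact: cdown].
- exact: maxV.
- exact: maxV.
- by rewrite mE; apply/cvg_lim => //; exact: cdown.
Qed.
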